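(* Let $\mathbb{F}=\mathbb{R}$ or $\mathbb{C}$, $n\ge1$, $A\in\mathbb{F}^{n\times n}$, let $\mathcal{S}$ be a $p$-dimensional linear subspace of $\mathbb{F}^n$, and let $q=\mathrm{Ind}_A(\mathcal{S})$. Let $V\in\mathbb{F}^{n\times p}$, $V'\in\mathbb{F}^{n\times q}$, $V''\in\mathbb{F}^{n\times(n-p-q)}$ be such that $\begin{bmatrix} V & V' & V'' \end{bmatrix}$ is unitary, $\mathcal{S}=\operatorname{Im}(V)$ and $\mathcal{S}+A\mathcal{S}=\operatorname{Im}(\begin{bmatrix} V & V' \end{bmatrix})$. Then $A$ has the block decomposition $$\begin{bmatrix} V^* \\ V'^* \\ V''^* \end{bmatrix} A \begin{bmatrix} V & V' & V'' \end{bmatrix} = \begin{bmatrix} T & P & Q \\ B & C & R \\ 0 & D & E \end{bmatrix},$$ with $T\in\mathbb{F}^{p\times p}$, $C\in\mathbb{F}^{q\times q}$, $E\in\mathbb{F}^{(n-p-q)\times(n-p-q)}$ and the other blocks of compatible shapes (in particular the $(3,1)$ block $V''^*AV$ vanishes). If $p=0$, or $q=0$, or $n-p-q=0$, this holds with the non-existent blocks and the corresponding non-existent $V,V',V''$ removed. If $q\ge1$, then $B$ has full rank $q$. Additionally: (i) If $A$ is invertible and $p\ge1$, then $H:=\begin{bmatrix} T \\ B \end{bmatrix}$ has full rank $p$. (ii) If $A$ is Hermitian, then $P=B^*$, $R=D^*$, $Q=0$, and $T,C,E$ are Hermitian.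
   Context: The index of invariance of a subspace $\mathcal{S}\subseteq\mathbb{F}^n$ with respect to $A\in\mathbb{F}^{n\times n}$ is $\mathrm{Ind}_A(\mathcal{S}):=\dim(\mathcal{S}+A\mathcal{S})-\dim(\mathcal{S})$, where $A\mathcal{S}=\{Ax:x\in\mathcal{S}\}$. $\operatorname{Im}$ denotes the column space and $M^*$ the conjugate transpose (transpose if $\mathbb{F}=\mathbb{R}$). *)

(* Defs.v *)
From HB Require Import structures.
From mathcomp Require Import all_boot all_order all_algebra.
From mathcomp Require Import complex.
From mathcomp Require Import reals.

Set Implicit Arguments.
Unset Strict Implicit.
Unset Printing Implicit Defensive.

Import GRing.Theory Num.Theory.
Local Open Scope ring_scope.

Variant scalar_kind := RealScalars | ComplexScalars.

(* F = R or C; K is a model of the real numbers. *)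
Definition scalars (K : realType) (k : scalar_kind) : numFieldType :=
  match k with
  | RealScalars => K : numFieldType
  | ComplexScalars => K[i]%C : numFieldType
  end.

Definition scalars_conj (K : realType) (k : scalar_kind) :
    scalars K k -> scalars K k :=
  match k return scalars K k -> scalars K k with
  | RealScalars => idfun
  | ComplexScalars => fun z : K[i]%C => z^*
  end.

Section Matrices.

Variables (K : realType) (k : scalar_kind).
Local Notation F := (scalars K k).

Definition adjmx (m n : nat) (M : 'M[F]_(m, n)) : 'M[F]_(n, m) :=
  (map_mx (@scalars_conj K k) M)^T.

(* The row and column counts are allowed to be syntactically distinct (as for
   a concatenation of blocks); the two identities together force m = n. *)
Definition unitary_mx (m n : nat) (U : 'M[F]_(m, n)) : Prop :=
  adjmx U *m U = 1%:M /\ U *m adjmx U = 1%:M.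

Definition hermitian_mx (n : nat) (M : 'M[F]_n) : Prop := adjmx M = M.

Definition im_mx (m n : nat) (M : 'M[F]_(m, n)) : {vspace 'cV[F]_m} :=
  limg (linfun (mulmx M : 'cV[F]_n -> 'cV[F]_m)).

Definition image_by (n : nat) (A : 'M[F]_n) (S : {vspace 'cV[F]_n}) :
    {vspace 'cV[F]_n} :=
  (linfun (mulmx A : 'cV[F]_n -> 'cV[F]_n) @: S)%VS.

(* The truncated subtraction is exact, since S is contained in S + A S. *)
Definition Ind (n : nat) (A : 'M[F]_n) (S : {vspace 'cV[F]_n}) : nat :=
  (\dim (S + image_by A S) - \dim S)%N.

(* [[M11, M12, M13], [M21, M22, M23], [M31, M32, M33]]; blocks with a zero
   dimension are empty matrices and contribute nothing. *)
Definition block3_mx (p q r : nat)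
    (M11 : 'M[F]_p) (M12 : 'M[F]_(p, q)) (M13 : 'M[F]_(p, r))
    (M21 : 'M[F]_(q, p)) (M22 : 'M[F]_q) (M23 : 'M[F]_(q, r))
    (M31 : 'M[F]_(r, p)) (M32 : 'M[F]_(r, q)) (M33 : 'M[F]_r) :
    'M[F]_(p + (q + r)) :=
  col_mx (row_mx M11 (row_mx M12 M13))
    (col_mx (row_mx M21 (row_mx M22 M23))
            (row_mx M31 (row_mx M32 M33))).

End Matrices.

(* Main.v *)
(** Im [V V'] = S + A S = Im [V AV].  Hence AV = [V V'] X, and V''^* kills both
    V and V', so V''^* A V = 0.  Conversely V' = V Y1 + A V Y2, and multiplying
    by V'^* gives 1 = B Y2, so B has a right inverse.  Since V V^* + V' V'^* +
    V'' V''^* = 1, AV = V T + V' B; if A is invertible this makes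
    V^* A^-1 [V V'] a left inverse of [T; B].  In the Hermitian case, transposing
    the blocks of U^* A U gives the symmetry. *)
Require Import Defs.
From HB Require Import structures.
From mathcomp Require Import all_boot all_order all_algebra.
From mathcomp Require Import complex.
From mathcomp Require Import reals.

Set Implicit Arguments.
Unset Strict Implicit.
Unset Printing Implicit Defensive.

Import GRing.Theory Num.Theory.
Local Open Scope ring_scope.

Section Adjoint.

Variables (K : realType) (k : scalar_kind).
Local Notation F := (scalars K k).

(** Once conjugation is registered as a ring morphism, the [map_mx] lemmas apply to [adjmx] for both
    scalar kinds at once. *)
Fact scalars_conj_is_zmod_morphism : zmod_morphism (@scalars_conj K k).
Proof. by case: k => // x y /=; rewrite rmorphB. Qed.

Fact scalars_conj_is_monoid_morphism : monoid_morphism (@scalars_conj K k).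
Proof. by case: k => //=; split=> [|x y]; rewrite ?rmorph1 ?rmorphM. Qed.

HB.instance Definition _ :=
  GRing.isZmodMorphism.Build F F (@scalars_conj K k)
    scalars_conj_is_zmod_morphism.
HB.instance Definition _ :=
  GRing.isMonoidMorphism.Build F F (@scalars_conj K k)
    scalars_conj_is_monoid_morphism.

Lemma scalars_conjK : involutive (@scalars_conj K k).
Proof. by case: k => //= x; rewrite conjCK. Qed.

Lemma adjmxK m n (M : 'M[F]_(m, n)) : adjmx (adjmx M) = M.
Proof. by apply/matrixP=> i j; rewrite !mxE scalars_conjK. Qed.

Lemma adjmxM m n r (M : 'M[F]_(m, n)) (N : 'M[F]_(n, r)) :
  adjmx (M *m N) = adjmx N *m adjmx M.
Proof. by rewrite /adjmx map_mxM trmx_mul. Qed.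

Lemma adjmx0 m n : adjmx (0 : 'M[F]_(m, n)) = 0.
Proof. by rewrite /adjmx map_mx0 trmx0. Qed.

Lemma adjmx_row m n r (M : 'M[F]_(m, n)) (N : 'M[F]_(m, r)) :
  adjmx (row_mx M N) = col_mx (adjmx M) (adjmx N).
Proof. by rewrite /adjmx map_row_mx tr_row_mx. Qed.

(** Source of all the symmetries in (ii): taking the adjoint of a block swaps the two frames between
    which [A] is compressed. *)
Lemma hermitian_compression m n r (A : 'M[F]_n) (M : 'M[F]_(n, m))
    (N : 'M[F]_(n, r)) :
  hermitian_mx A -> adjmx (adjmx M *m A *m N) = adjmx N *m A *m M.
Proof. by move=> hA; rewrite !adjmxM adjmxK hA mulmxA. Qed.

Lemma mem_im_mxP m n (M : 'M[F]_(m, n)) (v : 'cV[F]_m) :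
  reflect (exists x, v = M *m x) (v \in im_mx M).
Proof.
apply: (iffP memv_imgP) => [[x _ ->]|[x ->]]; exists x; rewrite ?memvf //;
by rewrite lfunE.
Qed.

(** Turns hypotheses on subspaces into matrix equations. Each column of [N] has a preimage under
    [M]; these preimages are the columns of [X]. *)
Lemma im_mx_subvP m n r (N : 'M[F]_(m, r)) (M : 'M[F]_(m, n)) :
  (im_mx N <= im_mx M)%VS <-> exists X, N = M *m X.
Proof.
split=> [/subvP sNM | [X ->]]; last first.
  by apply/subvP=> v /mem_im_mxP[x ->]; apply/mem_im_mxP; exists (X *m x);
    rewrite mulmxA.
have /fin_all_exists[x hx] (j : 'I_r) : exists x, col j N = M *m x.
  by apply/mem_im_mxP/sNM/mem_im_mxP; exists (delta_mx j 0); rewrite colE.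
exists (\matrix_(i, j) x j i 0); apply/matrixP=> i j.
have /matrixP/(_ i 0) := hx j; rewrite !mxE => ->.
by apply: eq_bigr => l _; rewrite mxE.
Qed.

Lemma image_by_im_mx m n (A : 'M[F]_n) (M : 'M[F]_(n, m)) :
  image_by A (im_mx M) = im_mx (A *m M).
Proof.
apply/vspaceP=> v; apply/memv_imgP/mem_im_mxP => [[_ /mem_im_mxP[x ->] ->]|].
  by exists x; rewrite lfunE /= mulmxA.
case=> x ->; exists (M *m x); last by rewrite lfunE /= mulmxA.
by apply/mem_im_mxP; exists x.
Qed.

Lemma im_mx_row m n r (M : 'M[F]_(m, n)) (N : 'M[F]_(m, r)) :
  im_mx (row_mx M N) = (im_mx M + im_mx N)%VS.
Proof.
apply/vspaceP=> v; apply/mem_im_mxP/memv_addP.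
  case=> x ->; rewrite -[x]vsubmxK mul_row_col.
  exists (M *m usubmx x); first by apply/mem_im_mxP; exists (usubmx x).
  exists (N *m dsubmx x); rewrite ?col_mxKu ?col_mxKd //.
  by apply/mem_im_mxP; exists (dsubmx x).
case=> _ /mem_im_mxP[x ->] [_ /mem_im_mxP[y ->] ->].
by exists (col_mx x y); rewrite mul_row_col.
Qed.

(** The orthogonality relations are blocks of U^* U = 1; the resolution of the identity is U U^* = 1
    expanded. *)
Lemma row_mx3_unitary n p q r (V : 'M[F]_(n, p)) (V' : 'M[F]_(n, q))
    (V'' : 'M[F]_(n, r)) :
  unitary_mx (row_mx V (row_mx V' V'')) ->
  [/\ adjmx V *m V = 1%:M, adjmx V' *m V' = 1%:M & adjmx V' *m V = 0] /\
  [/\ adjmx V'' *m V = 0, adjmx V'' *m V' = 0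
    & V *m adjmx V + V' *m adjmx V' + V'' *m adjmx V'' = 1%:M].
Proof.
case; rewrite !adjmx_row mul_col_row scalar_mx_block.
case/eq_block_mx=> VV _ WV; rewrite mul_col_row scalar_mx_block.
case/eq_block_mx=> V'V' _ V''V' _; rewrite !mul_row_col addrA => UU.
by move: WV; rewrite mul_col_mx -col_mx0 => /eq_col_mx[V'V V''V].
Qed.

End Adjoint.

(** The truncated [n - p - q] is exact, since p + q is the dimension of S + A S inside F^n. Empty
    blocks cover the degenerate cases. *)
Theorem corollary2p13 (K : realType) (k : scalar_kind) (n p q : nat)
    (hn : (1 <= n)%N)
    (A : 'M[scalars K k]_n) (S : {vspace 'cV[scalars K k]_n})
    (hp : \dim S = p) (hq : q = Ind A S)
    (V : 'M[scalars K k]_(n, p)) (V' : 'M[scalars K k]_(n, q))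
    (V'' : 'M[scalars K k]_(n, (n - p - q)%N))
    (hU : unitary_mx (row_mx V (row_mx V' V'')))
    (hV : S = im_mx V)
    (hV' : (S + image_by A S)%VS = im_mx (row_mx V V')) :
  exists (T : 'M[scalars K k]_p)
         (P : 'M[scalars K k]_(p, q))
         (Q : 'M[scalars K k]_(p, (n - p - q)%N))
         (B : 'M[scalars K k]_(q, p))
         (C : 'M[scalars K k]_q)
         (R : 'M[scalars K k]_(q, (n - p - q)%N))
         (D : 'M[scalars K k]_((n - p - q)%N, q))
         (E : 'M[scalars K k]_((n - p - q)%N)),
    [/\ col_mx (adjmx V) (col_mx (adjmx V') (adjmx V'')) *m A
          *m row_mx V (row_mx V' V'') =
          block3_mx T P Q
                    B C R
                    0 D E,
        adjmx V'' *m A *m V = 0,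
        (1 <= q)%N -> \rank B = q,
        A \in unitmx -> (1 <= p)%N -> \rank (col_mx T B) = p
      & hermitian_mx A ->
          [/\ P = adjmx B, R = adjmx D & Q = 0] /\
          [/\ hermitian_mx T, hermitian_mx C & hermitian_mx E]].
Proof.
have [[VV V'V' V'V] [V''V V''V' UU]] := row_mx3_unitary hU.
have hAV : im_mx (row_mx V (A *m V)) = im_mx (row_mx V V').
  by rewrite im_mx_row -image_by_im_mx -hV.
have [X AV] : exists X, A *m V = row_mx V V' *m X.
  by apply/im_mx_subvP; rewrite -hAV im_mx_row addvSr.
have [Y V'E] : exists Y, V' = row_mx V (A *m V) *m Y.
  by apply/im_mx_subvP; rewrite hAV im_mx_row addvSr.
have V''AV : adjmx V'' *m A *m V = 0.
  by rewrite -mulmxA AV mulmxA mul_mx_row V''V V''V' row_mx0 mul0mx.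
(* The blocks are forced: each is the product of [A] with one adjoint frame on the left and one
   frame on the right. *)
exists (adjmx V *m A *m V), (adjmx V *m A *m V'), (adjmx V *m A *m V''),
  (adjmx V' *m A *m V), (adjmx V' *m A *m V'), (adjmx V' *m A *m V''),
  (adjmx V'' *m A *m V'), (adjmx V'' *m A *m V'').
split=> //.
- by rewrite !mul_col_mx !mul_mx_row V''AV.
(* The lower part of [Y] holds the coefficients of V' along A V; the upper part disappears because
   V'^* V = 0. *)
- move=> _; apply/eqP/row_freeP; exists (dsubmx Y).
  rewrite -V'V' {3}V'E -{2}[Y]vsubmxK mul_row_col mulmxDr !mulmxA V'V.
  by rewrite mul0mx add0r.
- move=> uA _; apply/eqP/row_fullP.
  exists (adjmx V *m invmx A *m row_mx V V').
  rewrite -[LHS]mulmxA mul_row_col !mulmxA.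
  (* Insert the resolution of the identity in front of A V; its V'' term is zero by [V''AV]. *)
  have -> : V *m adjmx V *m A *m V + V' *m adjmx V' *m A *m V = A *m V.
    rewrite -[RHS]mul1mx -UU mulmxDl -(mulmxA V'') (mulmxA (adjmx V'')) V''AV.
    by rewrite mulmx0 addr0 mulmxDl !mulmxA.
  by rewrite mulmxA mulmxKV.
move=> hA; rewrite /hermitian_mx !hermitian_compression //.
do !split=> //.
(* Only Q = 0 remains: Q is the adjoint of the vanishing (3,1) block. *)
by rewrite -[LHS]adjmxK hermitian_compression // V''AV adjmx0.
Qed.
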